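(* Let $\mathcal{X}=\mathbb{R}/\mathbb{Z}$, let $f_c\in\mathbb{N}$, let $\tilde\varphi_D(x)=\sum_{|k|\le f_c}e^{2\pi i k x}$ and let $\varphi(x)=\tilde\varphi_D(\cdot-x)\in\mathcal{H}=L^2(\mathbb{R}/\mathbb{Z})$. Let $N\in\mathbb{N}$ and suppose $f_c=N$. Then for every $N$-tuple $Z=(z_1,\dots,z_N)$ of pairwise distinct points of $\mathcal{X}$ one has $\eta_{V,Z}(x)<1$ for all $x\notin\{z_1,\dots,z_N\}$, and there is a constant $C>0$ such that $$\eta_W(x)=1-C\sin^{2N}(\pi x)\quad\text{for all }x\in\mathcal{X}.$$ In particular $\eta_W(x)<1$ for all $x\in\mathcal{X}\setminus\{0\}$.
   Context: For $p\in\mathcal{H}$ write $(\Phi^*p)(x)=\langle\varphi(x),p\rangle_{\mathcal{H}}$ (a smooth function on $\mathcal{X}$). The vanishing pre-certificate is $\eta_{V,Z}=\Phi^*p_{V,Z}$ where $p_{V,Z}$ is the element of minimal $\mathcal{H}$-norm among all $p\in\mathcal{H}$ with $(\Phi^*p)(z_i)=1$ and $(\Phi^*p)'(z_i)=0$ for $i=1,\dots,N$. The limiting pre-certificate is $\eta_W=\Phi^*p_W$ where $p_W$ is the element of minimal $\mathcal{H}$-norm among all $p$ with $(\Phi^*p)(0)=1$ and $(\Phi^*p)^{(s)}(0)=0$ for $s=1,\dots,2N-1$. *)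

(* Defs.v *)
From HB Require Import structures.
From mathcomp Require Import all_boot all_order all_algebra.
From mathcomp Require Import all_classical all_reals all_analysis.
Set Implicit Arguments. Unset Strict Implicit. Unset Printing Implicit Defensive.
Import Order.TTheory GRing.Theory Num.Theory.
Import numFieldNormedType.Exports.
Local Open Scope classical_set_scope.
Local Open Scope ring_scope.

Section Defs.
Variable R : realType.

(* x is an integer: points of X = R/Z are represented by reals, and two reals
   denote the same point of X iff their difference is an integer. *)
Definition is_integer (x : R) : Prop := exists k : int, x = k%:~R.

(* Dirichlet kernel  phi~_D(x) = sum_{|k| <= fc} e^{2 pi i k x}
   = 1 + 2 sum_{k=1}^{fc} cos(2 pi k x)  (the sum is real). *)
Definition dirichlet (fc : nat) (x : R) : R :=
  1 + 2 * \sum_(1 <= k < fc.+1) cos (2 * pi * k%:R * x).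

(* H = L^2(R/Z): (representatives of) measurable functions on one period
   [0,1] with square-integrable modulus (real-valued). *)
Definition inH (p : R -> R) : Prop :=
  measurable_fun `[(0:R)%R, (1:R)%R] p /\
  (@lebesgue_measure R).-integrable `[(0:R)%R, (1:R)%R] (fun t => ((p t) ^+ 2)%:E).

Definition normH2 (p : R -> R) : R :=
  Rintegral (@lebesgue_measure R) `[(0:R)%R, (1:R)%R] (fun t => (p t) ^+ 2).

(* (Phi^* p)(x) = < phi(x), p >_H  with  phi(x) = phi~_D(. - x) *)
Definition PhiStar (fc : nat) (p : R -> R) (x : R) : R :=
  Rintegral (@lebesgue_measure R) `[(0:R)%R, (1:R)%R]
    (fun t => dirichlet fc (t - x) * p t).

Definition admV (fc N : nat) (z : 'I_N -> R) (p : R -> R) : Prop :=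
  inH p /\ forall i : 'I_N,
    PhiStar fc p (z i) = 1 /\ derive1 (PhiStar fc p) (z i) = 0.

Definition isMinV (fc N : nat) (z : 'I_N -> R) (p : R -> R) : Prop :=
  admV fc z p /\ forall q, admV fc z q -> normH2 p <= normH2 q.

Definition admW (fc N : nat) (p : R -> R) : Prop :=
  inH p /\ PhiStar fc p 0 = 1 /\
  forall s : nat, (1 <= s <= 2 * N - 1)%N -> (derive1n s (PhiStar fc p)) 0 = 0.

Definition isMinW (fc N : nat) (p : R -> R) : Prop :=
  admW fc N p /\ forall q, admW fc N q -> normH2 p <= normH2 q.

End Defs.

(* Main.v *)
(* The adjoint [PhiStar N] is the orthogonal projection of L^2 onto the
   trigonometric polynomials of degree at most [N].  When [fc = N], a
   certificate [eta] satisfies the interpolation constraints iff [1 - eta] has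
   the maximal number [2N] of zeros, counted with multiplicity, hence iff
   [1 - eta = c S], where [S] is the product of the [sin^2 (pi (x - z_i))]
   (all [z_i] being [0] for [eta_W]).  The minimal norm problem thus reduces to
   minimising [|1 - c S|^2 = 1 - 2 c <1, S> + c^2 |S|^2] over [c], and the
   minimiser [<1, S> / |S|^2] is positive because [S >= 0] is not zero. *)
Require Import Defs.
From HB Require Import structures.
From mathcomp Require Import all_boot all_order all_algebra.
From mathcomp Require Import all_classical all_reals all_analysis.
From mathcomp Require Import measurable_realfun zify ring lra.
Import Order.TTheory GRing.Theory Num.Theory.
Import numFieldNormedType.Exports.
Local Open Scope ring_scope.

Set Implicit Arguments.
Unset Strict Implicit.

(** * Binary forms in sine and cosine *)

Section TrigForm.
Context {R : realType}.
Implicit Types (f g h U V : R -> R) (x z a b : R) (k m n j : nat).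

(** * Differentiation rules for sines, cosines and products *)

Lemma is_derive_affine (a b x : R) :
  is_derive x 1 (fun y => a * y + b) a.
Proof.
have -> : (fun y => a * y + b) = (a \*: id) + cst b by apply/funext.
by apply: is_derive_eq; rewrite addr0 /GRing.scale /= mulr1.
Qed.

Lemma is_derive_sin_affine (a b x : R) :
  is_derive x 1 (fun y => sin (a * y + b)) (a * cos (a * x + b)).
Proof.
rewrite mulrC.
have H := is_derive1_comp (f := sin) (g := fun y => a * y + b) (x := x) _
  (is_derive_affine a b x).
exact: H (is_derive_sin (a * x + b)).
Qed.

Lemma is_derive_cos_affine (a b x : R) :
  is_derive x 1 (fun y => cos (a * y + b)) (- (a * sin (a * x + b))).
Proof.
rewrite mulrC -mulNr.
have H := is_derive1_comp (f := cos) (g := fun y => a * y + b) (x := x) _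
  (is_derive_affine a b x).
exact: H (is_derive_cos (a * x + b)).
Qed.

Lemma is_derive_mul f g x (df dg : R) : is_derive x 1 f df ->
  is_derive x 1 g dg ->
  is_derive x 1 (fun y => f y * g y) (df * g x + f x * dg).
Proof.
move=> Df Dg.
have -> : (fun y => f y * g y) = f * g by apply/funext.
apply: is_derive_eq; rewrite /GRing.scale /=; ring.
Qed.

Lemma is_derive_exp f x n (df : R) : is_derive x 1 f df ->
  is_derive x 1 (fun y => f y ^+ n.+1) (n.+1%:R * f x ^+ n * df).
Proof. by move=> Df; have := is_deriveX n.+1 Df; rewrite exprfctE. Qed.

Lemma is_derive_add f g x (df dg : R) : is_derive x 1 f df ->
  is_derive x 1 g dg ->
  is_derive x 1 (fun y => f y + g y) (df + dg).
Proof. by move=> Df Dg; exact: is_deriveD. Qed.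

Lemma is_derive_derive1 f df : (forall x, is_derive x 1 f (df x)) ->
  derive1 f = df.
Proof.
by move=> Df; apply/funext => x; rewrite derive1E; have [_ ->] := Df x.
Qed.

(* [trig_form n f]: [f] is a binary form of degree [n] in [sin (pi x)] and
   [cos (pi x)].  This notion is invariant under translation and, unlike that
   of a trigonometric polynomial, lets one simple zero be factored out at a
   time. *)
Fixpoint trig_form n f : Prop :=
  if n is n'.+1 then
    exists g h, [/\ trig_form n' g, trig_form n' h &
      f = fun x => sin (pi * x) * g x + cos (pi * x) * h x]
  else exists a, f = fun=> a.

Lemma trig_formD n f g : trig_form n f -> trig_form n g ->
  trig_form n (fun x => f x + g x).
Proof.
elim: n f g => [|n IH] f g /=.
  by move=> [a ->] [b ->]; exists (a + b).
move=> [f1 [f2 [Hf1 Hf2 ->]]] [g1 [g2 [Hg1 Hg2 ->]]].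
exists (fun x => f1 x + g1 x), (fun x => f2 x + g2 x).
by split; [exact: IH|exact: IH|apply/funext => x; ring].
Qed.

Lemma trig_formZ n a f : trig_form n f -> trig_form n (fun x => a * f x).
Proof.
elim: n f => [|n IH] f /=.
  by move=> [b ->]; exists (a * b).
move=> [f1 [f2 [Hf1 Hf2 ->]]].
exists (fun x => a * f1 x), (fun x => a * f2 x).
by split; [exact: IH|exact: IH|apply/funext => x; ring].
Qed.

Lemma trig_form_lincomb n a b f : trig_form n f ->
  trig_form n.+1 (fun x => (a * sin (pi * x) + b * cos (pi * x)) * f x).
Proof.
move=> Hf; exists (fun x => a * f x), (fun x => b * f x).
by split; [exact: trig_formZ|exact: trig_formZ|apply/funext => x; ring].
Qed.

Lemma trig_form_sinB n z f : trig_form n f ->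
  trig_form n.+1 (fun x => sin (pi * (x - z)) * f x).
Proof.
move=> /(trig_form_lincomb (cos (pi * z)) (- sin (pi * z))).
by congr trig_form; apply/funext => x; rewrite mulrBr sinB; ring.
Qed.

Lemma trig_form_cosB n z f : trig_form n f ->
  trig_form n.+1 (fun x => cos (pi * (x - z)) * f x).
Proof.
move=> /(trig_form_lincomb (sin (pi * z)) (cos (pi * z))).
by congr trig_form; apply/funext => x; rewrite mulrBr cosB; ring.
Qed.

(** The addition formulas express [sin (pi x)] and [cos (pi x)] linearly in the same functions of
    [x - z], with constant coefficients that [g] and [h] absorb. *)
Lemma trig_form_recenter n z f : trig_form n.+1 f ->
  exists g h, [/\ trig_form n g, trig_form n h &
    f = fun x => sin (pi * (x - z)) * g x + cos (pi * (x - z)) * h x].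
Proof.
move=> [g [h [Hg Hh ->]]].
exists (fun x => cos (pi * z) * g x + (- sin (pi * z)) * h x).
exists (fun x => sin (pi * z) * g x + cos (pi * z) * h x).
split; try by apply: trig_formD; exact: trig_formZ.
apply/funext => x.
rewrite [in LHS](_ : pi * x = pi * (x - z) + pi * z); last by ring.
by rewrite sinD cosD; ring.
Qed.

(** Recentred at [z], the form takes the value [h z] there, so [h] vanishes at [z] and, by induction
    on the degree, is itself divisible by the sine. In degree one [h] is constant, hence zero. *)
Lemma trig_form_factor n z f : trig_form n.+1 f -> f z = 0 ->
  exists2 g, trig_form n g & f = fun x => sin (pi * (x - z)) * g x.
Proof.
elim: n f => [|n IH] f /(trig_form_recenter z) [g [h [Hg Hh ->]]];
  rewrite subrr mulr0 sin0 cos0 mul0r mul1r add0r => h0.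
  exists g => //; apply/funext => x.
  by case: Hh h0 => b -> ->; rewrite mulr0 addr0.
have [h' Hh' ->] := IH _ Hh h0.
exists (fun x => g x + cos (pi * (x - z)) * h' x).
  by apply: trig_formD => //; exact: trig_form_cosB.
by apply/funext => x; ring.
Qed.

Lemma trig_form_derive n f : trig_form n f ->
  exists2 df, trig_form n df & forall x, is_derive x 1 f (df x).
Proof.
elim: n f => [|n IH] f /=.
  move=> [a ->]; exists (fun=> 0); first by exists 0.
  by move=> x; exact: is_derive_cst.
move=> [g [h [Hg Hh ->]]].
have [dg Hdg Dg] := IH _ Hg; have [dh Hdh Dh] := IH _ Hh.
exists (fun x => sin (pi * x) * (dg x + (- pi) * h x)
               + cos (pi * x) * (pi * g x + dh x)).
  eexists; eexists; split; last reflexivity;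
    by apply: trig_formD => //; exact: trig_formZ.
move=> x.
have Ds := is_derive_sin_affine pi 0 x.
have Dc := is_derive_cos_affine pi 0 x.
have E (t : R -> R) : (fun y => t (pi * y + 0)) = fun y => t (pi * y).
  by apply/funext => y; rewrite addr0.
rewrite E addr0 in Ds; rewrite E addr0 in Dc.
have := is_derive_add (is_derive_mul Ds (Dg x)) (is_derive_mul Dc (Dh x)).
by congr is_derive; ring.
Qed.

(** One differentiation lowers the order of the zero at [z] by one. The cofactor stays a form, and
    its value at [z] comes from the term in which the power of the sine is differentiated. *)
Lemma derive1_sinX_mul n m z U : trig_form n U ->
  exists2 V, trig_form n.+1 V /\ V z = m.+1%:R * pi * U z &
    derive1 (fun x => sin (pi * (x - z)) ^+ m.+1 * U x) =
    fun x => sin (pi * (x - z)) ^+ m * V x.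
Proof.
move=> HU; have [dU HdU DU] := trig_form_derive HU.
exists (fun x => cos (pi * (x - z)) * ((m.+1%:R * pi) * U x)
               + sin (pi * (x - z)) * dU x).
  split; last by rewrite subrr mulr0 sin0 cos0; ring.
  apply: trig_formD; last exact: trig_form_sinB.
  by apply: trig_form_cosB; exact: trig_formZ.
apply: is_derive_derive1 => x.
have E (t : R -> R) : (fun y => t (pi * y + - (pi * z)))
                    = fun y => t (pi * (y - z)).
  by apply/funext => y; rewrite mulrBr.
have Ds := is_derive_sin_affine pi (- (pi * z)) x.
rewrite E -mulrBr in Ds.
have Dp := is_derive_exp m Ds.
have := is_derive_mul Dp (DU x).
by congr is_derive; rewrite exprS; ring.
Qed.

Lemma derive1n_sinX_mul j m n z U : trig_form n U ->
  exists V c, [/\ c != 0, V z = c * U z &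
    derive1n j (fun x => sin (pi * (x - z)) ^+ (m + j) * U x) =
    fun x => sin (pi * (x - z)) ^+ m * V x].
Proof.
elim: j n U => [|j IH] n U HU.
  by exists U, 1; rewrite addn0 mul1r oner_neq0.
(* The first derivative is taken innermost, so that the induction hypothesis applies to its cofactor
   [V]. *)
rewrite /derive1n iterSr addnS.
have [V [HV Vz] ->] := derive1_sinX_mul (m + j) z HU.
have [W [c [c0 Wz E]]] := IH _ _ HV.
exists W, (c * ((m + j).+1%:R * pi)); split; last exact: E.
  by rewrite mulf_neq0// mulf_neq0 ?pnatr_eq0// gt_eqF// pi_gt0.
by rewrite Wz Vz; ring.
Qed.

Lemma derive1n_sinX_mul_eq0 j m n z U : trig_form n U -> (j < m)%N ->
  derive1n j (fun x => sin (pi * (x - z)) ^+ m * U x) z = 0.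
Proof.
move=> HU jm; rewrite -(subnK (ltnW jm)).
have [V [c [_ _ ->]]] := derive1n_sinX_mul j (m - j) z HU.
by rewrite subrr mulr0 sin0 expr0n subn_eq0 leqNgt jm mul0r.
Qed.

(** Once [sin ^+ m] has been factored out, the derivative of order [m] at [z] is a nonzero multiple
    of [U z]. Its vanishing allows one more sine to be extracted from [U]. *)
Lemma trig_form_factor_order m k z f : trig_form (m + k) f ->
  (forall j, (j < m)%N -> derive1n j f z = 0) ->
  exists2 U, trig_form k U & f = fun x => sin (pi * (x - z)) ^+ m * U x.
Proof.
elim: m k f => [|m IH] k f Hf f0.
  by exists f => //; apply/funext => x; rewrite expr0 mul1r.
rewrite addSnnS in Hf.
have [|U HU fE] := IH _ _ Hf.
  by move=> j jm; apply: f0; rewrite ltnS ltnW.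
have [V [c [c0 Vz E]]] := derive1n_sinX_mul m 0 z HU.
have := f0 m (ltnSn m); rewrite {1}fE E expr0 mul1r Vz.
move/eqP; rewrite mulf_eq0 (negbTE c0) /= => /eqP Uz.
have [W HW UE] := trig_form_factor HU Uz.
exists W => //; rewrite fE UE; apply/funext => x.
by rewrite exprSr mulrA.
Qed.

(* Multiplication by [sin^2 + cos^2 = 1]. *)
Lemma trig_form_add2 n f : trig_form n f -> trig_form n.+2 f.
Proof.
move=> Hf.
have := trig_formD (trig_form_sinB 0 (trig_form_sinB 0 Hf))
                   (trig_form_cosB 0 (trig_form_cosB 0 Hf)).
congr trig_form; apply/funext => x.
have := cos2Dsin2 (pi * (x - 0)); rewrite !expr2 => E.
rewrite -[RHS]mul1r -E; ring.
Qed.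

(** The angle grows by [2 pi x] from [k] to [k.+1], and the double-angle formulas are quadratic in
    [sin (pi x)] and [cos (pi x)]. *)
Lemma trig_form_cos_sin k :
  trig_form (2 * k) (fun x => cos (2 * pi * k%:R * x)) /\
  trig_form (2 * k) (fun x => sin (2 * pi * k%:R * x)).
Proof.
elim: k => [|k [IHc IHs]].
  split; [exists 1|exists 0]; apply/funext => x;
  by rewrite !(mulr0, mul0r) ?cos0 ?sin0.
have E x : 2 * pi * k.+1%:R * x = 2 * pi * k%:R * x + (pi * x + pi * x).
  by rewrite -addn1 natrD; ring.
have S2 g : trig_form (2 * k) g ->
    trig_form (2 * k.+1) (fun x => sin (pi * x + pi * x) * g x).
  rewrite mulnS !addSn add0n => Hg.
  have := trig_formZ 2 (trig_form_sinB 0 (trig_form_cosB 0 Hg)).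
  by congr trig_form; apply/funext => x; rewrite subr0 sinD; ring.
have C2 g : trig_form (2 * k) g ->
    trig_form (2 * k.+1) (fun x => cos (pi * x + pi * x) * g x).
  rewrite mulnS !addSn add0n => Hg.
  have := trig_formD (trig_form_cosB 0 (trig_form_cosB 0 Hg))
    (trig_formZ (-1) (trig_form_sinB 0 (trig_form_sinB 0 Hg))).
  by congr trig_form; apply/funext => x; rewrite subr0 cosD; ring.
split.
- have := trig_formD (C2 _ IHc) (trig_formZ (-1) (S2 _ IHs)).
  by congr trig_form; apply/funext => x; rewrite E (cosD (_ * k%:R * _)); ring.
- have := trig_formD (S2 _ IHc) (C2 _ IHs).
  by congr trig_form; apply/funext => x; rewrite E (sinD (_ * k%:R * _)); ring.
Qed.

(** A lower frequency is brought to the common degree [2 n] by [n - k] multiplications by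
    [sin^2 + cos^2], each adding two to the degree. *)
Lemma trig_form_cos_phase n k b : (k <= n)%N ->
  trig_form (2 * n) (fun x => cos (2 * pi * k%:R * x + b)).
Proof.
move=> /subnK <-; elim: (n - k)%N => [|d IH].
  have [Hc Hs] := trig_form_cos_sin k.
  have := trig_formD (trig_formZ (cos b) Hc) (trig_formZ (- sin b) Hs).
  by rewrite add0n; congr trig_form; apply/funext => x; rewrite cosD; ring.
by rewrite addSn mulnS; apply: trig_form_add2.
Qed.

(** A list with repetitions serves both certificates: distinct nodes for [eta_V], and [N] copies of
    0 for [eta_W]. *)
Definition sin2_prod (zs : seq R) x := \prod_(z <- zs) sin (pi * (x - z)) ^+ 2.

Lemma sin2_prod_cons z zs :
  sin2_prod (z :: zs) = fun x => sin (pi * (x - z)) ^+ 2 * sin2_prod zs x.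
Proof. by apply/funext => x; rewrite /sin2_prod big_cons. Qed.

Lemma sin2_prod_ge0 zs x : 0 <= sin2_prod zs x.
Proof. by apply: prodr_ge0 => z _; exact: sqr_ge0. Qed.

Lemma sin2_prod_le1 zs x : sin2_prod zs x <= 1.
Proof.
elim: zs => [|z zs IH]; first by rewrite /sin2_prod big_nil.
by rewrite sin2_prod_cons mulr_ile1 ?sqr_ge0 ?sin2_prod_ge0.
Qed.

Lemma trig_form_sin2_prod zs : trig_form (2 * size zs) (sin2_prod zs).
Proof.
elim: zs => [|z zs IH].
  by exists 1; apply/funext => x; rewrite /sin2_prod big_nil.
rewrite sin2_prod_cons [size _]/= mulnS !addSn add0n.
have := trig_form_sinB z (trig_form_sinB z IH).
by congr trig_form; apply/funext => x; rewrite mulrA expr2.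
Qed.

(** Moving [z] to the front of the list exhibits the factor [sin (pi (x - z)) ^+ 2], a zero of order
    at least two. *)
Lemma derive1_sin2_prod zs z : z \in zs -> derive1 (sin2_prod zs) z = 0.
Proof.
move=> zzs.
have -> : sin2_prod zs =
    fun x => sin (pi * (x - z)) ^+ 2 * sin2_prod (rem z zs) x.
  by rewrite -sin2_prod_cons; apply/funext => x;
     apply: perm_big; exact: perm_to_rem.
exact: (@derive1n_sinX_mul_eq0 1 2 _ _ _ (trig_form_sin2_prod _)).
Qed.

(** Each node removes a squared sine and two degrees. The quotient keeps its double zeros at the
    other nodes, where the removed factor is nonzero, and at the end a form of degree zero is
    left. *)
Lemma trig_form_double_zeros zs f :
    pairwise (fun z z' => sin (pi * (z' - z)) != 0) zs ->
    trig_form (2 * size zs) f ->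
    (forall z, z \in zs -> f z = 0 /\ derive1 f z = 0) ->
  exists c, f = fun x => c * sin2_prod zs x.
Proof.
elim: zs f => [|z zs IH] f.
  by move=> _ [a ->] _; exists a; apply/funext => x;
     rewrite /sin2_prod big_nil mulr1.
rewrite pairwise_cons [size _]/= mulnS => /andP[/allP zzs pzs] Hf f0.
have [|g Hg fE] := trig_form_factor_order (m := 2) (z := z) Hf.
  have [fz dfz] := f0 z (mem_head _ _).
  by case=> [|[|]].
have [|c gE] := IH _ pzs Hg.
  move=> z' z'zs; have [fz' dfz'] := f0 z' (mem_behead (s := z :: zs) z'zs).
  have /negbTE s0 := zzs _ z'zs.
  have gz' : g z' = 0.
    move: fz'; rewrite fE => /eqP; rewrite mulf_eq0 sqrf_eq0 s0 /=.
    by move/eqP.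
  split=> //.
  have [dg _ Dg] := trig_form_derive Hg.
  have [ds _ Ds] := trig_form_derive
    (trig_form_sinB z (trig_form_sinB z (ex_intro _ 1 erefl : trig_form 0 _))).
  (* At [z'] the factor [g] vanishes, so only the second term of the product rule remains there, and
     its squared sine is nonzero. *)
  have D : derive1 f = fun x => ds x * g x + sin (pi * (x - z)) ^+ 2 * dg x.
    apply: is_derive_derive1 => x; rewrite fE.
    have := is_derive_mul (Ds x) (Dg x).
    congr is_derive; last by ring.
    by apply/funext => y; ring.
  move: dfz'; rewrite D gz' mulr0 add0r (is_derive_derive1 Dg) => /eqP.
  by rewrite mulf_eq0 sqrf_eq0 s0 /= => /eqP.
exists c; rewrite fE gE sin2_prod_cons; apply/funext => x; ring.
Qed.

End TrigForm.

(** * The space L^2(R/Z) *)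

Section SinInteger.
Context {R : realType}.
Implicit Types (x y a : R).

Lemma sin_pi_int (m : int) : sin (pi * m%:~R) = 0 :> R.
Proof.
have N (n : nat) : sin (pi * n%:R) = 0 :> R.
  elim: n => [|n IH]; first by rewrite mulr0 sin0.
  by rewrite -addn1 natrD mulrDr sinD mulr1 IH sinpi; ring.
by case: m => n; rewrite ?NegzE ?mulrNz ?mulrN ?sinN N ?oppr0.
Qed.

Lemma cos_2pi_int (m : int) : cos (2 * pi * m%:~R) = 1 :> R.
Proof.
have -> : 2 * pi * m%:~R = pi * m%:~R + pi * m%:~R :> R by ring.
by rewrite cosD -!expr2 cos2sin2 sin_pi_int expr0n /= !subr0.
Qed.

Lemma sin_2pi_int (m : int) : sin (2 * pi * m%:~R) = 0 :> R.
Proof.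
have -> : 2 * pi * m%:~R = pi * m%:~R + pi * m%:~R :> R by ring.
by rewrite sinD sin_pi_int; ring.
Qed.

(** Subtracting the floor [n] leaves [x - n] in [[0, 1)], where [sin (pi (x - n))] is positive
    unless [x = n]. *)
Lemma sin_pi_eq0_is_integer x : sin (pi * x) = 0 -> is_integer x.
Proof.
have /andP[lex ltx] := floor_itv x; set n := Num.floor x in lex ltx *.
have -> : pi * x = pi * n%:~R + pi * (x - n%:~R) by ring.
rewrite sinD sin_pi_int mul0r add0r => /eqP; rewrite mulf_eq0.
have -> /= : (cos (pi * n%:~R) == 0 :> R) = false.
  apply/negbTE/eqP => c0; have := cos2Dsin2 (pi * n%:~R : R).
  by rewrite c0 sin_pi_int expr0n /= addr0 => /eqP; rewrite eq_sym oner_eq0.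
move=> /eqP s0; exists n; apply/eqP; rewrite eq_le lex andbT leNgt.
apply/negP => nx; suff : 0 < sin (pi * (x - n%:~R)) by rewrite s0 ltxx.
apply: sin_gt0_pi; rewrite mulr_gt0 ?pi_gt0 ?subr_gt0//=.
by rewrite gtr_pMr ?pi_gt0// ltrBlDl -[X in _ + X](mulr1z 1) -intrD.
Qed.

End SinInteger.

(** * Square-integrable functions, their inner product and the orthogonality of cosines *)

Section InnerProduct.
Context {R : realType}.
Local Notation mu := (@lebesgue_measure R).
Implicit Types (f g h p q : R -> R) (x a b : R).

Definition inner f g := Rintegral mu `[0, 1]%classic (fun t => f t * g t).

Lemma inH_continuous f : continuous f -> inH f.
Proof.
move=> cf; split.
  by apply: measurable_funTS; exact: continuous_measurable_fun.
apply: continuous_compact_integrable; first exact: segment_compact.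
apply: continuous_subspaceT => x.
have -> : (fun t => f t ^+ 2) = f * f by apply/funext => t; rewrite expr2.
by apply: continuousM; exact: cf.
Qed.

(** Domination by [f^2 + g^2]. *)
Lemma inH_mul_integrable f g : inH f -> inH g ->
  mu.-integrable `[0, 1]%classic (EFin \o (fun t => f t * g t)).
Proof.
move=> [mf if2] [mg ig2].
apply: (le_integrable _ _ _ (integrableD _ if2 ig2)) => //.
  by apply/measurable_EFinP; exact: measurable_funM.
move=> t _ /=; rewrite lee_fin normrM.
rewrite (@ger0_norm _ (f t ^+ 2 + g t ^+ 2)) ?addr_ge0 ?sqr_ge0//.
rewrite -(real_normK (num_real (f t))) -(real_normK (num_real (g t))).
have := normr_ge0 (f t); have := normr_ge0 (g t).
by nra.
Qed.

Lemma inHZ a f : inH f -> inH (fun x => a * f x).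
Proof.
move=> [mf if2]; split; first by apply: measurable_funM.
have : mu.-integrable `[0, 1]%classic (fun t => (a ^+ 2)%:E * (f t ^+ 2)%:E)%E.
  exact: integrableZl.
by congr (_.-integrable); apply/funext => t; rewrite -EFinM exprMn.
Qed.

Lemma inHD f g : inH f -> inH g -> inH (fun x => f x + g x).
Proof.
move=> Hf Hg; have ifg := inH_mul_integrable Hf Hg.
case: Hf Hg => [mf if2] [mg ig2]; split; first exact: measurable_funD.
have := integrableD _ (integrableD _ if2 ig2) (integrableZl _ 2 ifg).
move=> /(_ (measurable_itv _) (measurable_itv _) (measurable_itv _)).
congr (_.-integrable); apply/funext => t /=.
by rewrite -EFinM -!EFinD; congr EFin; ring.
Qed.

Lemma inH_cst a : inH (fun=> a).
Proof. by apply: inH_continuous => x; exact: cvg_cst. Qed.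

Lemma inH_sum n (F : nat -> R -> R) : (forall k, inH (F k)) ->
  inH (fun x => \sum_(k < n) F k x).
Proof.
move=> HF; elim: n => [|n IH].
  by under eq_fun do rewrite big_ord0; exact: inH_cst.
by under eq_fun do rewrite big_ord_recr /=; exact: inHD.
Qed.

Lemma innerC f g : inner f g = inner g f.
Proof. by apply: eq_Rintegral => t _; rewrite mulrC. Qed.

Lemma innerZl a f g : inH f -> inH g ->
  inner (fun x => a * f x) g = a * inner f g.
Proof.
move=> Hf Hg; rewrite -RintegralZl//; last exact: inH_mul_integrable.
by apply: eq_Rintegral => t _; rewrite mulrA.
Qed.

Lemma innerDl f h g : inH f -> inH h -> inH g ->
  inner (fun x => f x + h x) g = inner f g + inner h g.
Proof.
move=> Hf Hh Hg; rewrite -RintegralD//; try exact: inH_mul_integrable.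
by apply: eq_Rintegral => t _; rewrite mulrDl.
Qed.

Lemma inner_suml n (F : nat -> R -> R) g : (forall k, inH (F k)) -> inH g ->
  inner (fun x => \sum_(k < n) F k x) g = \sum_(k < n) inner (F k) g.
Proof.
move=> HF Hg; elim: n => [|n IH].
  rewrite big_ord0 -[RHS](mul0r (inner g g)) -innerZl//.
  by apply: eq_Rintegral => t _; rewrite big_ord0 !mul0r.
rewrite big_ord_recr /= -IH -innerDl//; last exact: inH_sum.
by apply: eq_Rintegral => t _; rewrite big_ord_recr.
Qed.

Lemma inner_ge0 f : 0 <= inner f f.
Proof. by apply: Rintegral_ge0 => t _; rewrite -expr2 sqr_ge0. Qed.

Lemma normH2E f : normH2 f = inner f f.
Proof. by apply: eq_Rintegral => t _; rewrite expr2. Qed.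

Lemma inner_add_scale a f g : inH f -> inH g ->
  inner (fun x => f x + a * g x) (fun x => f x + a * g x) =
  inner f f + 2 * a * inner f g + a ^+ 2 * inner g g.
Proof.
move=> Hf Hg; have Hag := inHZ a Hg; have Hfg := inHD Hf Hag.
rewrite innerDl// (innerC f) innerZl// (innerC g) !innerDl//.
by rewrite !(innerC f) !innerZl// (innerC g); ring.
Qed.

Lemma inner11 : inner (fun=> 1) (fun=> 1) = 1.
Proof.
rewrite /inner Rintegral_cst//= lebesgue_measure_itv/= lte_fin ltr01.
by rewrite oppr0 adde0 !mulr1.
Qed.

Lemma inner_le f g h k : inH f -> inH g -> inH h -> inH k ->
  (forall t, f t * g t <= h t * k t) -> inner f g <= inner h k.
Proof.
move=> Hf Hg Hh Hk le; apply: le_Rintegral => //; exact: inH_mul_integrable.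
Qed.

Lemma continuous_cos_affine a b : continuous (fun t : R => cos (a * t + b)).
Proof.
move=> x; apply: differentiable_continuous; apply/derivable1_diffP.
by have [] := is_derive_cos_affine a b x.
Qed.

Lemma inH_cos a b : inH (fun t : R => cos (a * t + b)).
Proof. exact/inH_continuous/continuous_cos_affine. Qed.

(** For [m != 0] the primitive [F] takes the same value at 0 and at 1. The frequency is a signed
    integer because differences of frequencies arise below. *)
Lemma Rintegral_cos (m : int) a :
  Rintegral mu `[0, 1]%classic (fun t => cos (2 * pi * m%:~R * t + a)) =
  (m == 0)%:R * cos a.
Proof.
have [->|m0] := eqVneq m 0.
  under eq_Rintegral do rewrite mulr0 mul0r add0r.
  rewrite Rintegral_cst//= lebesgue_measure_itv/= lte_fin ltr01.
  by rewrite oppr0 adde0 mulr1 mul1r.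
set c : R := 2 * pi * m%:~R.
have c0 : c != 0 by rewrite !mulf_neq0 ?pnatr_eq0 ?intr_eq0// gt_eqF ?pi_gt0.
pose F t := c^-1 * sin (c * t + a).
have DF x : is_derive x 1 F (cos (c * x + a)).
  have := is_derive_mul (is_derive_cst c^-1 x 1) (is_derive_sin_affine c a x).
  by congr is_derive; rewrite mul0r add0r mulrA mulVf// mul1r.
have cF : continuous F.
  move=> x; apply: differentiable_continuous; apply/derivable1_diffP.
  by have [] := DF x.
rewrite /Rintegral (continuous_FTC2 (F := F))//.
- rewrite /F -EFinB /= mulr1 mulr0 add0r sinD sin_2pi_int cos_2pi_int.
  by rewrite !mul0r !mul1r add0r subrr.
- by apply: continuous_subspaceT; exact: continuous_cos_affine.
- split; first by move=> x _; have [] := DF x.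
    exact/cvg_at_right_filter/cF.
  exact/cvg_at_left_filter/cF.
- by move=> x _; rewrite (is_derive_derive1 DF).
Qed.

(** The product formula splits the integrand into frequencies [k + l] and [k - l]; each integrates
    to zero unless its frequency is zero. *)
Lemma inner_cos_cos (k l : nat) a b :
  inner (fun t => cos (2 * pi * k%:R * t + a))
        (fun t => cos (2 * pi * l%:R * t + b)) =
  2^-1 * (((k + l)%N == 0)%:R * cos (a + b) + (k == l)%:R * cos (a - b)).
Proof.
pose C (m : int) c t : R := cos (2 * pi * m%:~R * t + c).
have HC m c : mu.-integrable `[0, 1]%classic (EFin \o C m c).
  have := inH_mul_integrable (inH_cst 1) (inH_cos (2 * pi * m%:~R) c).
  by congr (_.-integrable); apply/funext => t /=; rewrite mul1r.
transitivity (Rintegral mu `[0, 1]%classic (fun t =>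
    2^-1 * (C (k + l)%N (a + b) t + C (k%:Z - l%:Z) (a - b) t))).
  apply: eq_Rintegral => t _; rewrite /C.
  have -> : 2 * pi * ((k + l)%N : int)%:~R * t + (a + b) =
    (2 * pi * k%:R * t + a) + (2 * pi * l%:R * t + b).
    by rewrite -pmulrn natrD; ring.
  have -> : 2 * pi * (k%:Z - l%:Z)%:~R * t + (a - b) =
    (2 * pi * k%:R * t + a) - (2 * pi * l%:R * t + b).
    by rewrite intrB -!pmulrn; ring.
  by rewrite (cosD (_ + a)) (cosB (_ + a)); field.
rewrite RintegralZl//; last first.
  by apply: (integrableD _ (HC _ _) (HC _ _)).
by rewrite RintegralD// !Rintegral_cos subr_eq0 eqz_nat.
Qed.

End InnerProduct.

(** * Trigonometric polynomials and the Dirichlet kernel *)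

Section TrigPoly.
Context {R : realType}.
Implicit Types (f g p q : R -> R) (x a b : R) (k n N : nat).

(** The phase [b] makes one kind of generator cover sines and cosines; the closure clauses reduce
    linear statements to a single frequency. *)
Inductive trig_poly N : (R -> R) -> Prop :=
| trig_poly_cos k b : (k <= N)%N ->
    trig_poly N (fun x => cos (2 * pi * k%:R * x + b))
| trig_polyD f g : trig_poly N f -> trig_poly N g ->
    trig_poly N (fun x => f x + g x)
| trig_polyZ a f : trig_poly N f -> trig_poly N (fun x => a * f x).

Lemma trig_poly_cst N a : trig_poly N (fun=> a).
Proof.
have := trig_polyZ a (trig_poly_cos 0 (leq0n N)).
congr trig_poly; apply/funext => x.
by rewrite mulr0 mul0r addr0 cos0 mulr1.
Qed.

Lemma trig_poly_sum N n (F : nat -> R -> R) :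
  (forall k, (k < n)%N -> trig_poly N (F k)) ->
  trig_poly N (fun x => \sum_(k < n) F k x).
Proof.
elim: n => [|n IH] HF.
  by under eq_fun do rewrite big_ord0; exact: trig_poly_cst.
under eq_fun do rewrite big_ord_recr /=.
by apply: trig_polyD; [apply: IH => k kn; apply: HF; exact: ltnW|exact: HF].
Qed.

Lemma trig_poly_inH N f : trig_poly N f -> inH f.
Proof.
by elim=> [k b _|{}f g _ Hf _ Hg|a {}f _ Hf];
  [exact: inH_cos|exact: inHD|exact: inHZ].
Qed.

(** Passes from degree [N] in the angle [2 pi x] to degree [2 N] in [pi x], where zeros can be
    factored out singly. *)
Lemma trig_poly_form N f : trig_poly N f -> trig_form (2 * N) f.
Proof.
by elim=> [k b kN|{}f g _ Hf _ Hg|a {}f _ Hf];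
  [exact: trig_form_cos_phase|exact: trig_formD|exact: trig_formZ].
Qed.

Lemma trig_poly_widen N f : trig_poly N f -> trig_poly N.+1 f.
Proof.
by elim=> [k b kN|{}f g _ Hf _ Hg|a {}f _ Hf];
  [exact/trig_poly_cos/leqW|exact: trig_polyD|exact: trig_polyZ].
Qed.

Lemma trig_poly_mul_cos N f a : trig_poly N f ->
  trig_poly N.+1 (fun x => cos (2 * pi * x + a) * f x).
Proof.
elim=> [k b kN|{}f g _ Hf _ Hg|c {}f _ Hf]; last 2 first.
- have := trig_polyD Hf Hg.
  by congr trig_poly; apply/funext => x; ring.
- have := trig_polyZ c Hf.
  by congr trig_poly; apply/funext => x; ring.
have Hadd := trig_poly_cos (a + b) (kN : (k.+1 <= N.+1)%N).
(* For [k = 0] the frequency [k - 1] is negative; evenness of the cosine turns it into the frequency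
   1. *)
have Hsub : trig_poly N.+1 (fun x => cos (2 * pi * (k%:R - 1) * x + (b - a))).
  case: k kN {Hadd} => [_|k kN].
    have := trig_poly_cos (a - b) (ltn0Sn N).
    congr trig_poly; apply/funext => x.
    by rewrite -[RHS]cosN; congr cos; ring.
  have := trig_poly_cos (b - a) (leqW (ltnW kN)).
  by congr trig_poly; apply/funext => x; rewrite -natr1; congr cos; ring.
have := trig_polyZ 2^-1 (trig_polyD Hadd Hsub).
congr trig_poly; apply/funext => x.
have -> : 2 * pi * k.+1%:R * x + (a + b) =
  (2 * pi * k%:R * x + b) + (2 * pi * x + a) by rewrite -natr1; ring.
have -> : 2 * pi * (k%:R - 1) * x + (b - a) =
  (2 * pi * k%:R * x + b) - (2 * pi * x + a) by ring.
by rewrite (cosD (_ + b)) (cosB (_ + b)); field.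
Qed.

(** Since [sin^2 t = (1 - cos (2 t)) / 2], each factor raises the degree by at most one. *)
Lemma trig_poly_sin2_prod (zs : seq R) : trig_poly (size zs) (sin2_prod zs).
Proof.
elim: zs => [|z zs IH].
  rewrite /sin2_prod; under eq_fun do rewrite big_nil.
  exact: trig_poly_cst.
rewrite sin2_prod_cons /=.
have := trig_polyZ 2^-1 (trig_polyD (trig_poly_widen IH)
  (trig_polyZ (-1) (trig_poly_mul_cos (- (2 * pi * z)) IH))).
congr trig_poly; apply/funext => x.
have -> : 2 * pi * x - 2 * pi * z = pi * (x - z) + pi * (x - z) by ring.
by rewrite cosD -!expr2 cos2sin2; field.
Qed.

(** The exponentials of frequencies [k] and [-k] merge into one cosine of weight 2, whereas
    frequency 0 stands alone. *)
Definition dirichlet_weight k : R := if k == 0%N then 1 else 2.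

Lemma dirichletE N x : dirichlet N x =
  \sum_(k < N.+1) dirichlet_weight k * cos (2 * pi * k%:R * x).
Proof.
rewrite /dirichlet; elim: N => [|N IH].
  by rewrite big_geq// big_ord1 /= !(mulr0, mul0r) cos0 addr0 mulr1.
by rewrite big_nat_recr//= mulrDr addrA IH [RHS]big_ord_recr.
Qed.

Let dirichlet_term x k t : R :=
  dirichlet_weight k * cos (2 * pi * k%:R * t + - (2 * pi * k%:R * x)).

Let dirichlet_translate N x : (fun t => dirichlet N (t - x)) =
  (fun t => \sum_(k < N.+1) dirichlet_term x k t).
Proof.
apply/funext => t; rewrite dirichletE; apply: eq_bigr => k _.
by rewrite /dirichlet_term; congr (_ * cos _); ring.
Qed.

Lemma inH_dirichlet N x : inH (fun t => dirichlet N (t - x)).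
Proof.
rewrite dirichlet_translate; apply: inH_sum => k; exact/inHZ/inH_cos.
Qed.

Lemma PhiStarE N p x :
  PhiStar N p x = inner (fun t => dirichlet N (t - x)) p.
Proof. by []. Qed.

Lemma PhiStarZ N a p : inH p ->
  PhiStar N (fun x => a * p x) = fun x => a * PhiStar N p x.
Proof.
move=> Hp; apply/funext => x; have HD := inH_dirichlet N x.
by rewrite !PhiStarE innerC innerZl// innerC.
Qed.

Lemma PhiStarD N p q : inH p -> inH q ->
  PhiStar N (fun x => p x + q x) = fun x => PhiStar N p x + PhiStar N q x.
Proof.
move=> Hp Hq; apply/funext => x; have HD := inH_dirichlet N x.
by rewrite !PhiStarE innerC innerDl// !(innerC _ (fun t => dirichlet _ _)).
Qed.

(** The kernel separates the variables [t] and [x] by the subtraction formula. The phase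
    [- (pi / 2)] writes sines as cosines, in the shape of the generators of [trig_poly]. *)
Lemma PhiStar_sum N p : inH p ->
  PhiStar N p = fun x => \sum_(k < N.+1) dirichlet_weight k *
    (inner (fun t => cos (2 * pi * k%:R * t + 0)) p
       * cos (2 * pi * k%:R * x + 0)
     + inner (fun t => cos (2 * pi * k%:R * t + - (pi / 2))) p
       * cos (2 * pi * k%:R * x + - (pi / 2))).
Proof.
move=> Hp; apply/funext => x; rewrite PhiStarE dirichlet_translate.
rewrite inner_suml//; last by move=> k; exact/inHZ/inH_cos.
apply: eq_bigr => k _; rewrite innerZl//; last exact: inH_cos.
congr (_ * _).
rewrite [X in _ = X + _]mulrC [X in _ = _ + X]mulrC.
rewrite -[X in _ = X + _]innerZl; [|exact: inH_cos|exact: Hp].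
rewrite -[X in _ = _ + X]innerZl; [|exact: inH_cos|exact: Hp].
rewrite -innerDl//; try by apply: inHZ; exact: inH_cos.
apply: eq_Rintegral => t _; congr (_ * _).
by rewrite !addr0 !cosBpihalf cosD cosN sinN; ring.
Qed.

Lemma trig_poly_PhiStar N p : inH p -> trig_poly N (PhiStar N p).
Proof.
move=> Hp; rewrite PhiStar_sum//.
pose F k x := dirichlet_weight k *
    (inner (fun t => cos (2 * pi * k%:R * t + 0)) p
       * cos (2 * pi * k%:R * x + 0)
     + inner (fun t => cos (2 * pi * k%:R * t + - (pi / 2))) p
       * cos (2 * pi * k%:R * x + - (pi / 2))).
apply: (@trig_poly_sum N N.+1 F) => k kN.
apply: trig_polyZ; apply: trig_polyD; apply: trig_polyZ; exact: trig_poly_cos.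
Qed.

(** Reproducing property: by orthogonality only the term of frequency [l] of the kernel survives
    against a cosine of that frequency, and its weight cancels the normalisation. *)
Lemma PhiStar_id N f : trig_poly N f -> PhiStar N f = f.
Proof.
elim=> [l b lN|{}f g Hf IHf Hg IHg|a {}f Hf IHf]; last 2 first.
- by rewrite (PhiStarD _ (trig_poly_inH Hf) (trig_poly_inH Hg)) IHf IHg.
- by rewrite (PhiStarZ _ _ (trig_poly_inH Hf)) IHf.
apply/funext => x; rewrite PhiStarE dirichlet_translate.
rewrite inner_suml; last 2 first.
- by move=> k; exact/inHZ/inH_cos.
- exact: inH_cos.
have lN' : (l < N.+1)%N by [].
rewrite (bigD1 (Ordinal lN')) //= big1 ?addr0 => [|k kl].
  rewrite innerZl; [|exact: inH_cos|exact: inH_cos].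
  rewrite inner_cos_cos eqxx addnn double_eq0 /dirichlet_weight.
  have -> : cos (- (2 * pi * l%:R * x) - b) = cos (2 * pi * l%:R * x + b).
    by rewrite -cosN; congr cos; ring.
  (* For [l = 0] both terms of the product formula survive, which makes up for the weight 1 instead
     of 2. *)
  case: eqP => [->|_]; last by rewrite mul0r add0r mul1r mulVKf ?pnatr_eq0.
  by rewrite !(mulr0, mul0r, oppr0, add0r) /=; field.
rewrite innerZl; [|exact: inH_cos|exact: inH_cos].
have /negbTE kl' : (k : nat) != l.
  by apply: contra kl => /eqP kl; apply/eqP/val_inj.
rewrite inner_cos_cos kl' addn_eq0.
suff -> : ((k : nat) == 0%N) && (l == 0%N) = false.
  by rewrite !mul0r addr0 !mulr0.
by apply/negbTE/andP => -[/eqP k0 /eqP l0]; rewrite k0 l0 eqxx in kl'.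
Qed.

(** Both sides are the same weighted sum of products of the Fourier coefficients of [p] and [q]. *)
Lemma PhiStar_sym N p q : inH p -> inH q ->
  inner (PhiStar N p) q = inner p (PhiStar N q).
Proof.
move=> Hp Hq; rewrite [RHS]innerC !PhiStar_sum//.
have HF r k : inH (fun x => dirichlet_weight k *
    (inner (fun t => cos (2 * pi * k%:R * t + 0)) r
       * cos (2 * pi * k%:R * x + 0)
     + inner (fun t => cos (2 * pi * k%:R * t + - (pi / 2))) r
       * cos (2 * pi * k%:R * x + - (pi / 2)))).
  by apply: inHZ; apply: inHD; apply: inHZ; exact: inH_cos.
rewrite !(inner_suml _ (HF _))//; apply: eq_bigr => k _.
have HC b := inH_cos (2 * pi * k%:R) b.
have HZ c b := inHZ c (HC b).
rewrite !innerZl ?innerDl ?innerZl//; try exact: inHD.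
by ring.
Qed.

(** Symmetry and idempotence give [<p, Phi p> = |Phi p|^2], so that
    [0 <= |p - Phi p|^2 = |p|^2 - |Phi p|^2]. *)
Lemma normH2_PhiStar_le N p : inH p -> normH2 (PhiStar N p) <= normH2 p.
Proof.
move=> Hp; have Tp := trig_poly_PhiStar N Hp; have HT := trig_poly_inH Tp.
have E : inner p (PhiStar N p) = inner (PhiStar N p) (PhiStar N p).
  by rewrite (PhiStar_sym _ Hp HT) (PhiStar_id Tp).
have := inner_ge0 (fun x => p x + (-1) * PhiStar N p x).
by rewrite inner_add_scale// E !normH2E; lra.
Qed.

Lemma trig_poly_eq0 N f : trig_poly N f -> inner f f = 0 -> f = fun=> 0.
Proof.
move=> Tf f0; apply/funext => x; have Hf := trig_poly_inH Tf.
have HD := inH_dirichlet N x.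
pose e := inner (fun t => dirichlet N (t - x)) (fun t => dirichlet N (t - x)).
have e0 : 0 <= e by exact: inner_ge0.
(* The quadratic [a |-> |f + a D(. - x)|^2 = 2 a f(x) + a^2 e] is nonnegative,
   which is impossible for small [a] unless [f x = 0]. *)
have key a : 0 <= 2 * a * f x + a ^+ 2 * e.
  have := inner_ge0 (fun t => f t + a * dirichlet N (t - x)).
  rewrite inner_add_scale// f0 add0r [inner f _]innerC -PhiStarE.
  by rewrite (PhiStar_id Tf).
have e1 : 0 < e + 1 by lra.
(* The minimum of the quadratic would be at [- f x / e]; the denominator [e + 1] avoids dividing by
   zero and still gives a negative value unless [f x = 0]. *)
have := key (- f x / (e + 1)).
have -> : 2 * (- f x / (e + 1)) * f x + (- f x / (e + 1)) ^+ 2 * e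
  = - ((f x / (e + 1)) ^+ 2 * (e + 2)) by field; lra.
rewrite oppr_ge0 pmulr_lle0; last by lra.
rewrite le_eqVlt ltNge sqr_ge0 orbF sqrf_eq0 mulf_eq0 invr_eq0.
by rewrite (gt_eqF e1) orbF => /eqP.
Qed.

End TrigPoly.

(** * Pre-certificates *)

Section MinimalNorm.
Context {R : realType}.
Context {N : nat} {S : R -> R} {adm : (R -> R) -> Prop}.
Context (trig_poly_S : trig_poly N S) (S_ge0 : forall x, 0 <= S x)
  (S_le1 : forall x, S x <= 1) (S_neq0 : exists x, S x != 0).
Context (admP : forall p, adm p <->
  inH p /\ exists c, PhiStar N p = fun x => 1 + - c * S x).

Let A := inner (fun=> 1) S.
Let B := inner S S.

Let inH_S : inH S := trig_poly_inH trig_poly_S.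

Let B_gt0 : 0 < B.
Proof.
rewrite lt_def inner_ge0 andbT; apply/eqP => B0.
have [x] := S_neq0.
by rewrite (trig_poly_eq0 trig_poly_S B0) eqxx.
Qed.

(** From [0 <= S <= 1] follows [S^2 <= S], hence [B <= A]. *)
Let A_gt0 : 0 < A.
Proof.
apply: lt_le_trans B_gt0 _; apply: inner_le => //; first exact: inH_cst.
by move=> x; rewrite ler_wpM2r.
Qed.

Let candidate c x : R := 1 + - c * S x.

Let trig_poly_candidate c : trig_poly N (candidate c).
Proof. by apply: trig_polyD; [exact: trig_poly_cst|exact: trig_polyZ]. Qed.

Let normH2_candidate c : normH2 (candidate c) = 1 - 2 * c * A + c ^+ 2 * B.
Proof.
rewrite normH2E inner_add_scale//; last exact: inH_cst.
by rewrite inner11 -/A -/B; ring.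
Qed.

Let adm_candidate c : adm (candidate c).
Proof.
apply/admP; split; first exact: trig_poly_inH (trig_poly_candidate c).
by exists c; rewrite (PhiStar_id (trig_poly_candidate c)).
Qed.

Let adm_norm p c : inH p -> PhiStar N p = candidate c ->
  1 - 2 * c * A + c ^+ 2 * B <= normH2 p.
Proof.
by move=> Hp E; rewrite -normH2_candidate -E normH2_PhiStar_le.
Qed.

Let opt_norm : normH2 (candidate (A / B)) = 1 - A ^+ 2 / B.
Proof. by rewrite normH2_candidate; field; rewrite gt_eqF. Qed.

(** Completing the square: the quadratic in [c] exceeds its value at [A / B] by
    [B (c - A / B)^2]. *)
Lemma min_norm_exists :
  exists p, adm p /\ forall q, adm q -> normH2 p <= normH2 q.
Proof.
exists (candidate (A / B)); split; first exact: adm_candidate.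
move=> q /admP[Hq [c E]]; apply: le_trans (adm_norm Hq E).
rewrite opt_norm -subr_ge0.
have -> : 1 - 2 * c * A + c ^+ 2 * B - (1 - A ^+ 2 / B)
        = B * (c - A / B) ^+ 2 by field; rewrite gt_eqF.
by rewrite mulr_ge0 ?sqr_ge0// ltW.
Qed.

(** If [c <= 0], the quadratic bounding the norm from below is at least 1, whereas the candidate at
    [A / B] has squared norm [1 - A^2 / B < 1]. *)
Lemma min_norm_certificate p :
    (adm p /\ forall q, adm q -> normH2 p <= normH2 q) ->
  exists2 C, 0 < C & forall x, PhiStar N p x = 1 - C * S x.
Proof.
move=> [/admP[Hp [c E]] pmin].
exists c; last by move=> x; rewrite E mulNr.
have := le_trans (adm_norm Hp E) (pmin _ (adm_candidate (A / B))).
rewrite opt_norm ltNge => le; apply/negP => c0.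
have : 0 < A ^+ 2 / B by rewrite divr_gt0// exprn_gt0.
have : 0 <= - c * A by rewrite mulr_ge0 ?oppr_ge0// ltW.
have : 0 <= c ^+ 2 * B by rewrite mulr_ge0 ?sqr_ge0// ltW.
by lra.
Qed.

End MinimalNorm.

(** * Interpolation constraints as zeros with multiplicity *)

Section Certificates.
Context {R : realType}.
Implicit Types (p : R -> R) (zs : seq R) (x z : R) (N : nat).

Lemma exists_noncongruent N (z : 'I_N -> R) :
  exists x, forall i, ~ is_integer (x - z i).
Proof.
(* Each [z i] is congruent to at most one of the points [j / (N + 1)]. *)
pose pt (j : 'I_N.+1) : R := j%:R / N.+1%:R.
apply: contrapT => noc.
have /choice[f fP] : forall j, exists i, is_integer (pt j - z i).
  move=> j; apply: contrapT => nf; apply: noc; exists (pt j) => i ii.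
  by apply: nf; exists i.
have finj : injective f.
  move=> j j' fj; have [m mE] := fP j; have [m' m'E] := fP j'.
  apply/val_inj/eqP => /=; rewrite -eqz_nat -subr_eq0.
  have : ((j%:Z - j'%:Z)%:~R : R) = ((m - m') * N.+1%:Z)%:~R.
    rewrite intrM !intrB -mE -m'E fj /pt -!pmulrn.
    have : N.+1%:R != 0 :> R by rewrite pnatr_eq0.
    by move: (N.+1%:R : R) => d d0; field.
  move=> /intr_inj E; rewrite E.
  have jl := ltn_ord j; have j'l := ltn_ord j'.
  move: (m - m')%R E => d E.
  (* A nonzero [d] would separate [j] and [j'] by at least [N + 1], but both lie between 0 and
     [N]. *)
  by case: (ltgtP d 0) => [d0|d0|->]; [nia|nia|rewrite mul0r].
by have := leq_card f finj; rewrite !card_ord ltnn.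
Qed.

Lemma sin2_prod_neq0 N (z : 'I_N -> R) x : (forall i, ~ is_integer (x - z i)) ->
  sin2_prod [seq z i | i <- enum 'I_N] x != 0.
Proof.
move=> nz; rewrite /sin2_prod prodf_seq_neq0; apply/allP => _ /mapP[i _ ->] /=.
by rewrite sqrf_eq0; apply/eqP => /sin_pi_eq0_is_integer; exact: nz.
Qed.

Lemma trig_form_oneB N p : inH p ->
  trig_form (2 * N) (fun x => 1 + -1 * PhiStar N p x).
Proof.
move=> Hp; apply: trig_poly_form; apply: trig_polyD; first exact: trig_poly_cst.
exact/trig_polyZ/trig_poly_PhiStar.
Qed.

(** Transfers derivative conditions between [eta] and [1 - eta]; the order is at least one so that
    the constant [a] disappears. *)
Lemma derive1n_affine j n f a b : trig_form n f ->
  derive1n j.+1 (fun x : R => a + b * f x) =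
  fun x => b * derive1n j.+1 f x.
Proof.
elim: j n f a => [|j IH] n f a Hf; have [df Hdf Df] := trig_form_derive Hf;
  have E : derive1 (fun x => a + b * f x) = fun x => 0 + b * df x.
1,3: apply: is_derive_derive1 => x;
  have := is_derive_add (is_derive_cst a x 1)
    (is_derive_mul (is_derive_cst b x 1) (Df x));
  by congr is_derive; rewrite mul0r add0r.
- by rewrite /derive1n /= E (is_derive_derive1 Df);
    apply/funext => x; rewrite add0r.
- rewrite /derive1n !(iterSr j.+1) E (is_derive_derive1 Df).
  exact: IH Hdf.
Qed.

(** Double zeros of [1 - eta] at [N] incongruent points exhaust the degree [2 N] and leave a
    constant factor. Conversely, the product has a zero of order two or more at each [z i]. *)
Lemma admV_iff N (z : 'I_N -> R) p :
    (forall i j : 'I_N, i != j -> ~ is_integer (z i - z j)) ->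
  admV N z p <-> inH p /\ exists c, PhiStar N p =
    fun x => 1 + - c * sin2_prod [seq z i | i <- enum 'I_N] x.
Proof.
move=> nz; set zs := map _ _.
have szs : size zs = N by rewrite size_map size_enum_ord.
have zzs i : z i \in zs by rewrite map_f// mem_enum.
split=> [[Hp Hz]|[Hp [c E]]]; split=> //.
  have HT := trig_form_oneB N Hp.
  have Hf := trig_poly_form (trig_poly_PhiStar N Hp).
  have [| |w /mapP[i _ ->]|c cE] := @trig_form_double_zeros _ zs
    (fun x => 1 + -1 * PhiStar N p x).
  - rewrite pairwise_map; have := enum_uniq 'I_N; rewrite uniq_pairwise.
    apply: sub_pairwise => i j /= ij; apply/eqP => /sin_pi_eq0_is_integer.
    by apply: nz; rewrite eq_sym.
  - by rewrite szs.
  - have [-> d0] := Hz i; split; first by ring.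
    by have /= := derive1n_affine 0 1 (-1) Hf; rewrite /derive1n /= => ->;
      rewrite d0 mulr0.
  - exists c; apply/funext => x.
    have := congr1 (fun f => f x) cE; rewrite /=; lra.
move=> i; rewrite E; split.
  rewrite (_ : sin2_prod zs (z i) = 0) ?mulr0 ?addr0//.
  apply/eqP; rewrite /sin2_prod prodf_seq_eq0; apply/hasP; exists (z i) => //=.
  by rewrite subrr mulr0 sin0 expr0n.
have := derive1n_affine 0 1 (- c) (trig_form_sin2_prod zs).
rewrite /derive1n /= => ->.
by rewrite derive1_sin2_prod// mulr0.
Qed.

Lemma sin2_prod_nseq N x :
  sin2_prod (nseq N 0) x = sin (pi * x) ^+ (2 * N).
Proof.
elim: N => [|N IH]; first by rewrite /sin2_prod big_nil expr0.
by rewrite [nseq _ _]/= sin2_prod_cons IH subr0 mulnS exprD.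
Qed.

(** Here a single zero of order [2 N] at 0 exhausts the degree. *)
Lemma admW_iff N p : (0 < N)%N ->
  admW N N p <-> inH p /\ exists c, PhiStar N p =
    fun x => 1 + - c * sin2_prod (nseq N 0) x.
Proof.
move=> N0.
have sinE (U : R -> R) a : U = (fun=> a) ->
    (fun x => sin (pi * (x - 0)) ^+ (2 * N) * U x) =
    fun x => a * sin2_prod (nseq N 0) x.
  by move=> ->; apply/funext => x; rewrite sin2_prod_nseq subr0 mulrC.
split=> [[Hp [H0 Hs]]|[Hp [c E]]]; split=> //.
  (* Writing the degree as [2 N + 0] makes the cofactor a form of degree zero, that is, a
     constant. *)
  have HT := trig_form_oneB N Hp; rewrite -[(2 * N)%N]addn0 in HT.
  have Hf := trig_poly_form (trig_poly_PhiStar N Hp).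
  have [|U [a Ua] UE] := trig_form_factor_order (z := 0) HT.
    case=> [|j] jN; first by rewrite derive1n0 H0; ring.
    by rewrite (derive1n_affine _ _ _ Hf) Hs ?mulr0//; lia.
  exists a; apply/funext => x; rewrite (sinE _ _ Ua) in UE.
  have := congr1 (fun f => f x) UE; rewrite /=; lra.
have HS := trig_form_sin2_prod (nseq N (0 : R)).
have S0 j : (j < 2 * N)%N -> derive1n j (sin2_prod (nseq N 0)) 0 = 0 :> R.
  move=> jN; rewrite (_ : sin2_prod _ =
    fun x => sin (pi * (x - 0)) ^+ (2 * N) * (fun=> 1) x); last first.
    by apply/funext => x; rewrite sin2_prod_nseq subr0 mulr1.
  by apply: (@derive1n_sinX_mul_eq0 R j (2 * N) 0) => //; exists 1.
(* Positivity of [N] enters here: the empty product would be 1. *)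
have E0 : sin2_prod (nseq N 0) 0 = 0 :> R.
  by apply: (S0 0%N); rewrite muln_gt0.
rewrite E; split; first by rewrite E0 mulr0 addr0.
case=> [//|s] sN; rewrite (derive1n_affine _ _ _ HS) S0 ?mulr0//; lia.
Qed.

End Certificates.

Unset Implicit Arguments.

(** Existence of a minimiser accompanies each claim about all minimisers, so that these claims are
    not vacuous. *)
Theorem mainTheorem1 (R : realType) (fc N : nat) (hN : (0 < N)%N) (hfc : fc = N) :
  (forall z : 'I_N -> R,
      (forall i j : 'I_N, i != j -> ~ is_integer (z i - z j)) ->
      (exists p : R -> R, isMinV fc z p) /\
      (forall p : R -> R, isMinV fc z p ->
         forall x : R, (forall i : 'I_N, ~ is_integer (x - z i)) ->
           PhiStar fc p x < 1)) /\
  (exists p : R -> R, isMinW fc N p) /\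
  (forall p : R -> R, isMinW fc N p ->
     (exists C : R, 0 < C /\
        forall x : R, PhiStar fc p x = 1 - C * (sin (pi * x)) ^+ (2 * N)) /\
     (forall x : R, ~ is_integer x -> PhiStar fc p x < 1)).
Proof.
subst fc.
have subC_lt1 (C s : R) : 0 < C -> 0 <= s -> s != 0 -> 1 - C * s < 1.
  by move=> C0 s0 sN0; rewrite gtrBl mulr_gt0// lt_def sN0.
split=> [z nz|].
  pose zs := [seq z i | i <- enum 'I_N].
  have TS : trig_poly N (sin2_prod zs).
    by have := trig_poly_sin2_prod zs; rewrite size_map size_enum_ord.
  have S0 : exists x, sin2_prod zs x != 0.
    by have [x /sin2_prod_neq0] := exists_noncongruent z; exists x.
  have Aiff p := admV_iff p nz.
  split; first exact: (min_norm_exists TS S0 Aiff).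
  move=> p /(min_norm_certificate TS (@sin2_prod_ge0 R zs)
    (@sin2_prod_le1 R zs) S0 Aiff) [C C0 CE] x xz.
  by rewrite CE subC_lt1 ?sin2_prod_ge0 ?sin2_prod_neq0.
pose S := sin2_prod (nseq N (0 : R)).
have TS : trig_poly N S.
  by have := trig_poly_sin2_prod (nseq N (0 : R)); rewrite size_nseq.
have S_neq0 x : ~ is_integer x -> S x != 0.
  move=> nx; rewrite /S sin2_prod_nseq expf_neq0//.
  by apply/eqP => /sin_pi_eq0_is_integer.
have S0 : exists x, S x != 0.
  (* At [x = 1/2] the sine equals 1. *)
  by exists (2^-1); rewrite /S sin2_prod_nseq sin_pihalf expr1n oner_neq0.
have Aiff (p : R -> R) := admW_iff p hN.
split; first exact: (min_norm_exists TS S0 Aiff).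
move=> p /(min_norm_certificate TS (@sin2_prod_ge0 R _)
  (@sin2_prod_le1 R _) S0 Aiff) [C C0 CE].
split=> [|x nx]; last by rewrite CE subC_lt1 ?sin2_prod_ge0 ?S_neq0.
by exists C; split=> // x; rewrite CE /S sin2_prod_nseq.
Qed.
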